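(* Let $N=\{1,\dots,n\}$ ($n\ge1$) be a set of agents and $M$ a finite set of indivisible goods, and suppose every agent $i\in N$ has a normalized, monotone, leveled valuation $v_i:2^M\to\mathbb{R}_{\ge0}$. Then there exists a complete allocation $A=(A_1,\dots,A_n)\in\Pi_n(M)$ that is envy-free up to any good (EFX): for all $i,j\in N$ and all $g\in A_j$, $v_i(A_i)\ge v_i(A_j\setminus\{g\})$.
   Context: A valuation $v:2^M\to\mathbb{R}_{\ge0}$ is normalized if $v(\emptyset)=0$, monotone if $v(S)\le v(T)$ whenever $S\subseteq T$, and leveled if $v(S)>v(T)$ for all $S,T\subseteq M$ with $|S|>|T|$. $\Pi_n(M)$ is the set of all tuples $(A_1,\dots,A_n)$ of pairwise disjoint (possibly empty) subsets of $M$ whose union is $M$. *)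

(* Defs.v *)
From mathcomp Require Import all_boot all_order all_algebra.
From mathcomp Require Import reals.

Set Implicit Arguments.
Unset Strict Implicit.
Unset Printing Implicit Defensive.

Import Order.TTheory GRing.Theory Num.Theory.

Local Open Scope ring_scope.

Definition nonnegative (R : realType) (M : finType) (v : {set M} -> R) : Prop :=
  forall S : {set M}, 0 <= v S.

Definition normalized (R : realType) (M : finType) (v : {set M} -> R) : Prop :=
  v set0 = 0.

Definition monotone (R : realType) (M : finType) (v : {set M} -> R) : Prop :=
  forall S T : {set M}, S \subset T -> v S <= v T.

Definition leveled (R : realType) (M : finType) (v : {set M} -> R) : Prop :=
  forall S T : {set M}, (#|T| < #|S|)%N -> v T < v S.

(* Bundles may be empty, so this is weaker than [finset.partition]. *)
Definition complete_allocation (n : nat) (M : finType)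
    (A : 'I_n -> {set M}) : Prop :=
  (forall i j : 'I_n, i != j -> [disjoint A i & A j])
  /\ \bigcup_(i < n) A i = [set: M].

Definition EFX (R : realType) (n : nat) (M : finType)
    (v : 'I_n -> {set M} -> R) (A : 'I_n -> {set M}) : Prop :=
  forall (i j : 'I_n) (g : M), g \in A j -> v i (A j :\ g) <= v i (A i).

(* Main.v *)
Require Import Defs.
From mathcomp Require Import all_boot all_order all_algebra.
From mathcomp Require Import reals.
From mathcomp Require Import zify.

(** Let the agents choose one after the other: when [r] agents remain and the
    set of remaining goods is [S], the next agent takes a best subset of [S] of
    size [floor (#|S| / r)].  Every later bundle then has this size or one more.
    So the chooser ranks a later bundle minus a good no higher than its own
    bundle, by levelness or by its choice, while a later agent ranks the
    chooser's bundle minus a good strictly lower, by levelness. *)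

Import Order.TTheory.

Lemma best_subset_of_card (d : Order.disp_t) (T : orderType d) (M : finType)
    (w : {set M} -> T) (S : {set M}) (k : nat) :
  k <= #|S| ->
  exists B : {set M}, [/\ B \subset S, #|B| = k &
    forall C : {set M}, C \subset S -> #|C| = k -> (w C <= w B)%O].
Proof.
rewrite -bin_gt0 -cards_draws => /card_gt0P[B0]; rewrite inE => PB0.
pose P (B : {set M}) := (B \subset S) && (#|B| == k).
have [B /andP[sBS /eqP cB] maxB] := @arg_maxP _ _ _ B0 P w PB0.
by exists B; split=> // C sCS cC; apply: maxB; rewrite /P sCS cC eqxx.
Qed.

(** Encoding an allocation as a map from goods to agents makes bundles disjoint by construction;
    values of [f] outside [S] are ignored. *)
Definition bundle {I : eqType} {M : finType} (S : {set M}) (f : M -> I) (i : I) :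
  {set M} := [set x in S | f x == i].

(** Quantifying over [q] places each bundle size between the floor and the ceiling of
    [#|S| / size s] without division. The induction carries these bounds because comparisons with
    the current chooser rest on them. *)
Lemma sequential_choice (R : realType) (I : eqType) (i0 : I) (M : finType)
    (v : I -> {set M} -> R) (v_leveled : forall i, leveled (v i))
    (s : seq I) (S : {set M}) :
  uniq s -> (s = [::] -> S = set0) ->
  exists f : M -> I, [/\ forall x, x \in S -> f x \in s,
    forall i, i \in s -> forall q,
      (q * size s <= #|S| -> q <= #|bundle S f i|)
      /\ (#|S| <= q * size s -> #|bundle S f i| <= q) &
    forall i j, i \in s -> j \in s -> forall g, g \in bundle S f j ->
      (v i (bundle S f j :\ g) <= v i (bundle S f i))%O].
Proof.
elim: s S => [|i s IHs] S.
  (* No goods are left, so the default [i0] only makes [f] total. *)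
  move=> _ /(_ erefl) ->; exists (fun=> i0).
  by split=> // x; rewrite inE.
case/andP=> iNs us _; set k := #|S| %/ size (i :: s).
have kS : k * (size s).+1 <= #|S| by apply: leq_trunc_div.
have Sk : #|S| < k.+1 * (size s).+1 by apply: ltn_ceil.
have leKS : k <= #|S| by exact: leq_div.
have [B [sBS cB maxB]] := best_subset_of_card _ _ _ (v i) S k leKS.
have cSB : #|S :\: B| = #|S| - k by rewrite cardsDS ?cB.
(* The last agent has [k = #|S|] and takes everything. *)
have SB0 : s = [::] -> S :\: B = set0.
  move=> s0; apply/eqP; rewrite -cards_eq0 cSB subn_eq0.
  by move: Sk; rewrite s0 /= muln1 ltnS.
have [f [fs fcard fEFX]] := IHs _ us SB0.
pose f' x := if x \in B then i else f x.
have bi : bundle S f' i = B.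
  apply/setP=> x; rewrite inE /f'.
  have [xB|xNB] := boolP (x \in B); first by rewrite (subsetP sBS) ?eqxx.
  have [xS /=|//] := boolP (x \in S).
  have xSB : x \in S :\: B by rewrite inE xNB.
  by apply: contraNF iNs => /eqP <-; apply: fs.
have bj j : j \in s -> bundle S f' j = bundle (S :\: B) f j.
  move=> js; apply/setP=> x; rewrite !inE /f'.
  have [xB|//] := boolP (x \in B).
  by rewrite andFb; apply/andP=> -[_ /eqP ij]; rewrite ij js in iNs.
(* By [kS] and [Sk], removing [k] goods leaves at least [k * size s] and at most [k.+1 * size s]. *)
have lo j : j \in s -> k <= #|bundle (S :\: B) f j|.
  by move=> js; apply: (fcard j js k).1; rewrite cSB; lia.
have hi j : j \in s -> #|bundle (S :\: B) f j| <= k.+1.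
  by move=> js; apply: (fcard j js k.+1).2; rewrite cSB; lia.
exists f'; split.
- move=> x xS; rewrite /f' inE; case: (boolP (x \in B)) => [_|xNB].
    by rewrite eqxx.
  by rewrite fs ?orbT // inE xNB.
- move=> j + q; rewrite inE => /predU1P[->|js].
    by rewrite bi cB /=; split=> ?; nia.
  rewrite bj //=; have := lo j js; have := hi j js => hij loj.
  split=> [?|Sq]; first by apply: leq_trans loj; nia.
  (* If [q <= k], taking [k] goods from at most [q * (size s).+1] leaves at most [q * size s], as
     the induction hypothesis requires. *)
  have [kq|qk] := ltnP k q; first exact: leq_trans hij kq.
  by apply: (fcard j js q).2; rewrite cSB; nia.
- move=> j l; rewrite !(in_cons i) => jis lis g; move: jis lis.
  case/predU1P=> [->|js] /predU1P[->|ls].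
  + rewrite bi => gB; apply/ltW/v_leveled.
    by rewrite [X in _ < X](cardsD1 g) gB.
  + rewrite bi bj // => gl; have := hi l ls.
    (* If exactly [k] goods remain without [g], they form a subset of [S] that competed with [B]. *)
    rewrite (cardsD1 g) gl add1n ltnS leq_eqVlt => /predU1P[ck|ltk].
      apply: maxB => //; apply/subsetP=> x.
      by rewrite !inE => /andP[_ /andP[/andP[_ ->]]].
    by apply/ltW/v_leveled; rewrite cB.
  + rewrite bi bj // => gB; apply/ltW/v_leveled.
    apply: leq_trans (lo j js); rewrite -cB.
    by rewrite [X in _ < X](cardsD1 g) gB.
  + by rewrite !bj //; apply: fEFX.
Qed.

Theorem theorem4 (R : realType) (n : nat) (hn : (1 <= n)%N) (M : finType)
    (v : 'I_n -> {set M} -> R)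
    (v_nonneg : forall i : 'I_n, nonnegative (v i))
    (v_normalized : forall i : 'I_n, normalized (v i))
    (v_monotone : forall i : 'I_n, monotone (v i))
    (v_leveled : forall i : 'I_n, leveled (v i)) :
  exists A : 'I_n -> {set M}, complete_allocation A /\ EFX v A.
Proof.
have agents0 : enum 'I_n = [::] -> [set: M] = set0.
  by move/(congr1 size); rewrite size_enum_ord => n0; rewrite n0 in hn.
have [f [_ _ fEFX]] := sequential_choice _ _ (Ordinal hn) _ v v_leveled _ _
  (enum_uniq 'I_n) agents0.
exists (bundle [set: M] f); split; last first.
  by move=> i j g; apply: fEFX; rewrite mem_enum.
split=> [i j ij|].
  rewrite -setI_eq0; apply/eqP/setP=> x; rewrite !inE /=.
  by apply/andP=> -[/eqP fi /eqP fj]; rewrite -fi fj eqxx in ij.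
by apply/setP=> x; rewrite inE; apply/bigcupP; exists (f x); rewrite ?inE ?eqxx.
Qed.
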